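(* Let $G$ and $H$ be nontrivial, connected graphs, both of which have girth at least $5$. Then the Cartesian product $G \Box H$ is well-covered if and only if $G \Box H \cong K_2 \Box K_2$ or $G \Box H \cong C_5 \Box K_2$.
   Context: All graphs are finite and simple; ''nontrivial'' means having at least two vertices. A graph is well-covered if all its maximal independent sets have the same cardinality. The girth of a graph is the length of its shortest cycle, and is $\infty$ if the graph is a forest. The Cartesian product $G \Box H$ has vertex set $V(G)\times V(H)$, with $(g_1,h_1)$ adjacent to $(g_2,h_2)$ if either $g_1=g_2$ and $h_1h_2\in E(H)$, or $h_1=h_2$ and $g_1g_2\in E(G)$. *)

(* Defs.v *)
From mathcomp Require Import all_boot.

Set Implicit Arguments.
Unset Strict Implicit.
Unset Printing Implicit Defensive.

Record sgraph := SGraph {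
  vertex :> finType;
  adj : rel vertex;
  adj_sym : symmetric adj;
  adj_irr : irreflexive adj
}.
Arguments adj {s}.

Definition nontrivial (G : sgraph) : bool := 1 < #|G|.

Definition connected (G : sgraph) : Prop := forall x y : G, connect adj x y.

Definition independent (G : sgraph) (A : {set G}) : bool :=
  [forall x in A, forall y in A, ~~ adj x y].

Definition well_covered (G : sgraph) : Prop :=
  forall A B : {set G},
    maxset (@independent G) A -> maxset (@independent G) B -> #|A| = #|B|.

(* [ucycleb] also accepts sequences of size 0 and 2, which are not cycles of
   a simple graph, hence the lower bound on the length. *)
Definition has_cycle_of_length (G : sgraph) (n : nat) : bool :=
  (2 < n) && [exists c : n.-tuple G, ucycleb adj c].

(* [None] stands for infinity. The vertices of a cycle are distinct, so its
   length is at most [#|G|]. *)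
Definition girth (G : sgraph) : option nat :=
  ohead [seq n <- iota 0 #|G|.+1 | has_cycle_of_length G n].

Definition girth_at_least (k : nat) (G : sgraph) : bool :=
  if girth G is Some g then k <= g else true.

Definition isomorphic (G H : sgraph) : Prop :=
  exists2 f : G -> H, bijective f & forall x y : G, adj (f x) (f y) = adj x y.

Section CartesianProduct.
Variables G H : sgraph.

Definition cart_adj : rel (G * H) := fun u v =>
  (u.1 == v.1) && adj u.2 v.2 || (u.2 == v.2) && adj u.1 v.1.

Fact cart_adj_sym : symmetric cart_adj.
Proof.
by move=> u v; rewrite /cart_adj (eq_sym u.1) (eq_sym u.2)
  (adj_sym u.1) (adj_sym u.2).
Qed.

Fact cart_adj_irr : irreflexive cart_adj.
Proof. by move=> u; rewrite /cart_adj !adj_irr !andbF. Qed.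

Definition cartesian : sgraph := SGraph cart_adj_sym cart_adj_irr.
End CartesianProduct.

Notation "G □ H" := (cartesian G H) (at level 40, left associativity).

Section StandardGraphs.
Variable n : nat.

Definition complete_adj : rel 'I_n := fun x y => x != y.

Fact complete_adj_sym : symmetric complete_adj.
Proof. by move=> x y; rewrite /complete_adj eq_sym. Qed.

Fact complete_adj_irr : irreflexive complete_adj.
Proof. by move=> x; rewrite /complete_adj eqxx. Qed.

Definition complete_graph : sgraph := SGraph complete_adj_sym complete_adj_irr.

(* The condition [x != y] only matters for [n = 1]; this is the cycle on [n]
   vertices when [n >= 3]. *)
Definition cycle_adj : rel 'I_n := fun x y =>
  (x != y) && ((y == ordS x) || (x == ordS y)).

Fact cycle_adj_sym : symmetric cycle_adj.
Proof. by move=> x y; rewrite /cycle_adj eq_sym orbC. Qed.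

Fact cycle_adj_irr : irreflexive cycle_adj.
Proof. by move=> x; rewrite /cycle_adj eqxx. Qed.

Definition cycle_graph : sgraph := SGraph cycle_adj_sym cycle_adj_irr.
End StandardGraphs.

(* Main.v *)
Require Import Defs.
From mathcomp Require Import all_boot zify.

(** In a well-covered graph, no independent set [I] can leave undominated exactly
    a vertex [x] and at least two pairwise nonadjacent neighbours of [x]: it would
    extend to a maximal independent set by [x] alone, or by those neighbours.
    Applied to suitable sets in [G □ H], this obstruction first excludes leaves,
    so each factor is [K_2] or has minimum degree at least 2, and then excludes
    two factors of minimum degree at least 2. For [H = K_2], let [d] be the minimum
    degree of [G]. If [d = 2], the two neighbours of a vertex [v] of degree 2 have
    perfectly matched neighbourhoods (outside [v]); adjacent vertices of degree 2
    then force [G = C_5], and otherwise the vertices of degree 2 are independent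
    and are themselves the obstruction. If [d >= 3], a greedy choice either gives
    the obstruction or shows that around a vertex of degree [d] all neighbourhoods
    are matched as in a Moore graph; the neighbourhood of a third neighbour is
    then the obstruction. *)

Set Implicit Arguments.
Unset Strict Implicit.
Unset Printing Implicit Defensive.

(** * Neighbourhoods and the consequences of girth at least five *)

Definition nb (G : sgraph) (x : G) : {set G} := [set y | adj x y].

Definition C3free (G : sgraph) :=
  forall x y z : G, adj x y -> adj y z -> adj z x -> False.

(** Absence of 4-cycles in the form in which it is used: two distinct vertices have at most one
    common neighbour. *)
Definition C4free (G : sgraph) :=
  forall x y u v : G, x != y ->
    adj x u -> adj y u -> adj x v -> adj y v -> u = v.

Lemma in_nb (G : sgraph) (x y : G) : (y \in nb x) = adj x y.
Proof. by rewrite inE. Qed.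

Lemma adj_neq (G : sgraph) (x y : G) : adj x y -> x != y.
Proof. by apply: contraTneq => ->; rewrite adj_irr. Qed.

Lemma independentP (G : sgraph) (A : {set G}) :
  reflect (forall x y, x \in A -> y \in A -> adj x y -> False)
          (independent A).
Proof.
apply: (iffP forall_inP) => [iA x y xA yA|iA x xA].
  by move/forall_inP: (iA x xA) => /(_ y yA) /negP.
by apply/forall_inP => y yA; apply/negP => /(iA x y xA yA).
Qed.

Lemma maxset_ext (G : sgraph) (A : {set G}) :
  independent A -> exists2 B : {set G}, maxset (@independent G) B & A \subset B.
Proof. by move=> iA; have [B ? ?] := maxset_exists iA; exists B. Qed.

(** The length of [c] lies in the increasing list of cycle lengths whose head is the girth, so the
    girth would be less than 5. *)
Lemma girth5_no_cycle (G : sgraph) (c : seq G) :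
  girth_at_least 5 G -> 2 < size c < 5 -> ~~ ucycleb adj c.
Proof.
move=> gG /andP[c_gt2 c_lt5]; apply/negP => cyc_c; move: gG.
have : size c \in [seq n <- iota 0 #|G|.+1 | has_cycle_of_length G n].
  rewrite mem_filter mem_iota /= add0n ltnS; apply/andP; split.
    by rewrite /has_cycle_of_length c_gt2; apply/existsP; exists (in_tuple c).
  by case/andP: cyc_c => _ /card_uniqP <-; apply: max_card.
rewrite /girth_at_least /girth.
have := sorted_filter leq_trans (has_cycle_of_length G)
  (iota_sorted 0 #|G|.+1).
case: [seq _ <- _ | _] => //= n s /(order_path_min leq_trans) /allP n_min.
by rewrite inE => /predU1P[<-|/n_min]; lia.
Qed.

Lemma girth5_C3free (G : sgraph) : girth_at_least 5 G -> C3free G.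
Proof.
move=> gG x y z xy yz zx.
have /negP[] := girth5_no_cycle (c := [:: x; y; z]) gG isT.
rewrite /ucycleb /= xy yz zx /= !inE !negb_or.
by rewrite (adj_neq xy) (adj_neq yz) eq_sym (adj_neq zx).
Qed.

Lemma girth5_C4free (G : sgraph) : girth_at_least 5 G -> C4free G.
Proof.
move=> gG x y u v xy xu yu xv yv; apply/eqP/negPn/negP => uv.
have /negP[] := girth5_no_cycle (c := [:: x; u; y; v]) gG isT.
rewrite /ucycleb /= xu (adj_sym u) yu yv (adj_sym v) xv /= !inE !negb_or.
rewrite (adj_neq xu) xy (adj_neq xv) uv (adj_neq yv).
by rewrite (eq_sym u) (adj_neq yu).
Qed.

Ltac graph_split := repeat (subst; match goal with
  | H : is_true (_ && _) |- _ => move: H => /andP[? ?]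
  | H : is_true (_ || _) |- _ => move: H => /orP[?|?]
  | H : is_true (_ == _) |- _ => move: H => /eqP ?
  | H : (_, _) = (_, _) |- _ => case: H => ? ?
  end); subst.

(** Triangles are recognised however their edges are directed: the nested match covers the
    transitive orientations, the last pattern the cyclic ones. *)
Ltac graph_contra :=
  match goal with
  | H : is_true (adj ?x ?x) |- _ => by rewrite adj_irr in H
  | H : is_true (?x != ?x) |- _ => by rewrite eqxx in H
  | H : is_true ?b, H' : is_true (~~ ?b) |- _ => by rewrite H in H'
  | H : is_true (adj ?x ?y), H' : is_true (~~ adj ?y ?x) |- _ =>
      by rewrite adj_sym H in H'
  | T : C3free ?G, H : is_true (@adj ?G ?x ?y), H1 : is_true (@adj ?G ?x ?z) |- _ =>
    match goal with
    | H2 : is_true (adj y z) |- _ =>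
      by case: (T x y z H H2); rewrite adj_sym
    | H2 : is_true (adj z y) |- _ =>
      by case: (T x z y H1 H2); rewrite adj_sym
    end
  | T : C3free ?G, H : is_true (@adj ?G ?x ?y), H1 : is_true (@adj ?G ?y ?z),
      H2 : is_true (@adj ?G ?z ?x) |- _ => by case: (T x y z H H1 H2)
  end.

(* Complete [x |: I] to a maximal independent set. The domination hypothesis
   keeps it away from [a] and [b], so replacing [x] by [a] and [b] gives a
   larger independent set. *)
Lemma well_covered_swap (G : sgraph) (x a b : G) (I : {set G}) :
  well_covered G -> adj x a -> adj x b -> a != b -> ~~ adj a b ->
  independent (x |: I) ->
  (forall y, adj a y || adj b y -> y != x -> exists2 z, z \in I & adj y z) ->
  False.
Proof.
move=> wc xa xb nab nadj ixI dom.
have [K maxK sIK] := maxset_ext ixI.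
have /maxsetP[/independentP iK _] := maxK.
have xK : x \in K by apply: (subsetP sIK); rewrite !inE eqxx.
have far y : y \in K -> y != x -> ~~ (adj a y || adj b y).
  move=> yK yx; apply/negP => /dom /(_ yx)[z zI].
  by apply: iK => //; apply: (subsetP sIK); rewrite !inE zI orbT.
have aK : a \notin K by apply/negP => /(iK _ _ xK) /(_ xa).
have bK : b \notin K by apply/negP => /(iK _ _ xK) /(_ xb).
have iK' : independent (a |: (b |: (K :\ x))).
  apply/independentP => y z; rewrite !inE.
  case/or3P=> [/eqP->|/eqP->|/andP[yx yK]]; case/or3P=> [/eqP->|/eqP->|/andP[zx zK]].
  - by rewrite adj_irr.
  - by apply/negP.
  - by have := far _ zK zx; rewrite negb_or => /andP[/negP].
  - by rewrite adj_sym; apply/negP.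
  - by rewrite adj_irr.
  - by have := far _ zK zx; rewrite negb_or => /andP[_ /negP].
  - by rewrite adj_sym; have := far _ yK yx; rewrite negb_or => /andP[/negP].
  - by rewrite adj_sym; have := far _ yK yx; rewrite negb_or => /andP[_ /negP].
  - exact: iK.
have [L maxL /subset_leq_card] := maxset_ext iK'.
rewrite (wc _ _ maxL maxK) !cardsU1 !inE (negPf aK) (negPf bK) !andbF.
by rewrite (negPf nab) /= (cardsD1 x K) xK ltnn.
Qed.

Lemma connected_closed (G : sgraph) (A : {set G}) (x : G) :
  connected G -> x \in A -> (forall y z, y \in A -> adj y z -> z \in A) ->
  A = setT.
Proof.
move=> cG xA clA; apply/setP => y; rewrite inE.
have clA' : closed adj (mem A).
  by apply: intro_closed => [u v|u v uv /clA]; [exact: sym_connect_sym (@adj_sym G) _ _ | apply].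
by rewrite -(closed_connect clA' (cG x y)).
Qed.

Lemma connected_nb (G : sgraph) (x : G) :
  nontrivial G -> connected G -> exists y, adj x y.
Proof.
move=> ntG cG; have [/existsP //|/existsPn nox] := boolP [exists y, adj x y].
have A1 : [set x] = setT.
  apply: (connected_closed (x := x) cG); rewrite ?inE // => y z.
  by rewrite inE => /eqP-> xz; have := nox z; rewrite xz.
by move: ntG; rewrite /nontrivial -cardsT -A1 cards1.
Qed.

Lemma cart_adjE (G H : sgraph) (g g' : G) (h h' : H) :
  @adj (G □ H) (g, h) (g', h') = (g == g') && adj h h' || (h == h') && adj g g'.
Proof. by []. Qed.

(** * Leaves and pairs of factors of minimum degree two *)

(** The obstruction is centred at [(l, h)], with neighbours [(g, h)] and [(l, h1)]. As [l] is a
    leaf, the only neighbour of [(l, h1)] in the direction of [G] is [(g, h1)]. *)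
Lemma no_leaf (G H : sgraph) (l g g' : G) (h h1 : H) :
  well_covered (G □ H) -> C3free G -> C3free H ->
  nb l = [set g] -> adj g g' -> g' != l -> adj h h1 -> False.
Proof.
move=> wc G3 H3 nl gg' g'l hh1.
have lE (y : G) : adj l y = (y == g) by rewrite -in_nb nl inE.
have lg : adj l g by rewrite lE.
(* Up to the centre, the first block dominates the neighbours of [(g, h)], among them [(g, h1)]; the
   second dominates the neighbours of [(l, h1)] in the direction of [H]. *)
pose I : {set G □ H} :=
  setX (nb g :\ l) (nb h) :|: setX [set g] (nb h1 :\ h).
apply: (well_covered_swap (x := (l, h) : G □ H) (a := (g, h)) (b := (l, h1)) (I := I) wc).
- by rewrite cart_adjE eqxx lg orbT.
- by rewrite cart_adjE eqxx hh1.
- by rewrite xpair_eqE eq_sym (negPf (adj_neq lg)).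
- by rewrite cart_adjE eq_sym (negPf (adj_neq lg)) (negPf (adj_neq hh1)).
- apply/independentP => -[a b] [c d]; rewrite cart_adjE !inE /= ?xpair_eqE ?lE => A B C.
  graph_split; try graph_contra.
- case=> a b; rewrite !cart_adjE xpair_eqE lE.
  case/orP=> /orP[] /andP[/eqP<- ab] B.
  + by exists (g', b); rewrite ?cart_adjE ?inE /= ?eqxx ?gg' ?g'l ?ab ?orbT.
  + exists (a, h1); rewrite ?cart_adjE ?inE /= ?eqxx ?hh1 //.
    by move: B; rewrite eqxx andbT => ->; rewrite ab.
  + exists (g, b); rewrite ?cart_adjE ?inE /= ?eqxx ?lg ?ab ?orbT //.
    by move: B; rewrite eqxx /= => ->; rewrite ?orbT.
  + by rewrite (eqP ab); exists (g', h1); rewrite ?cart_adjE ?inE /= ?eqxx ?gg' ?g'l ?hh1 ?orbT.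
Qed.

(** By [no_leaf], a vertex of degree 1 and its neighbour are closed under adjacency, hence are all
    of [G]. *)
Lemma min_deg_ge2 (G H : sgraph) :
  nontrivial G -> nontrivial H -> connected G -> connected H ->
  C3free G -> C3free H -> well_covered (G □ H) ->
  #|G| = 2 \/ forall g : G, 1 < #|nb g|.
Proof.
move=> ntG ntH cG cH G3 H3 wc.
have [/forallP allG|] := boolP [forall g : G, 1 < #|nb g|]; first by right.
rewrite negb_forall => /existsP[l]; rewrite -leqNgt => deg_l; left.
have [g lg] := connected_nb l ntG cG.
have [h _] : exists h : H, true by case/card_gt1P: ntH => h _; exists h.
have [h1 hh1] := connected_nb h ntH cH.
have nl : nb l = [set g].
  by apply/eqP; rewrite eq_sym eqEcard cards1 deg_l sub1set in_nb lg.
have gl g' : adj g g' -> g' = l.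
  by move=> gg'; apply/eqP/negPn/negP => g'l; apply: no_leaf wc G3 H3 nl gg' g'l hh1.
have A : [set l; g] = setT.
  apply: (connected_closed (x := l) cG) => [|y z]; rewrite !inE ?eqxx //.
  by case/orP=> /eqP-> => [|/gl->]; rewrite ?eqxx // -in_nb nl inE => ->; rewrite orbT.
by rewrite -cardsT -A cards2 (adj_neq lg).
Qed.

(** Obstruction centred at [(g, h)] with both neighbours in the layer of [h]. To be dominated are
    the copies of [g1] and [g2] in the adjacent layers and the further neighbours of [g1] and [g2]
    in the layer itself. *)
Lemma no_path_star (G H : sgraph) (g g1 g2 : G) (h : H) (I : {set G □ H}) :
  well_covered (G □ H) -> C3free G ->
  adj g g1 -> adj g g2 -> g1 != g2 -> independent I ->
  (forall z, z \in I -> adj ((g, h) : G □ H) z -> False) ->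
  (forall h', adj h h' -> exists2 z, z \in I & adj ((g1, h') : G □ H) z) ->
  (forall h', adj h h' -> exists2 z, z \in I & adj ((g2, h') : G □ H) z) ->
  (forall s, adj g1 s || adj g2 s -> s != g ->
     exists2 z, z \in I & adj ((s, h) : G □ H) z) ->
  False.
Proof.
move=> wc G3 gg1 gg2 g12 /independentP iI xI dom1 dom2 domS.
apply: (well_covered_swap (x := (g, h) : G □ H) (a := (g1, h)) (b := (g2, h)) (I := I) wc).
- by rewrite cart_adjE eqxx gg1 orbT.
- by rewrite cart_adjE eqxx gg2 orbT.
- by rewrite xpair_eqE (negPf g12).
- rewrite cart_adjE (negPf g12) eqxx /=; apply/negP => g1g2.
  by apply: (G3 g g1 g2); rewrite // adj_sym.
- apply/independentP => y z; rewrite !in_setU1.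
  case/predU1P=> [->|yI]; case/predU1P=> [->|zI]; first by rewrite adj_irr.
  + exact: xI.
  + by rewrite adj_sym; apply: xI.
  + exact: iI.
- case=> s h'; rewrite !cart_adjE xpair_eqE.
  case/orP=> /orP[]/andP[/eqP<- A] B.
  + exact: dom1.
  + by apply: domS; [rewrite A | move: B; rewrite eqxx andbT].
  + exact: dom2.
  + by apply: domS; [rewrite A orbT | move: B; rewrite eqxx andbT].
Qed.

Lemma C4free_path (G : sgraph) (g g1 g2 s : G) :
  C4free G -> adj g g1 -> adj g g2 -> g1 != g2 ->
  adj g1 s -> adj g2 s -> s != g -> False.
Proof.
move=> G4 gg1 gg2 g12 g1s g2s /negP; apply.
by apply/eqP; apply: (G4 g1 g2); rewrite // adj_sym.
Qed.

Lemma other_nb (G : sgraph) (x y : G) :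
  1 < #|nb y| -> exists2 z, adj y z & z != x.
Proof.
move=> /card_gt1P[a [b [ya yb ab]]]; move: ya yb; rewrite !in_nb => ya yb.
have [ax|ax] := eqVneq a x; last by exists a.
by exists b; rewrite // -ax eq_sym.
Qed.

Lemma third_nb (G : sgraph) (x x' y : G) :
  2 < #|nb y| -> exists z, [/\ adj y z, z != x & z != x'].
Proof.
move=> dy; have : 0 < #|nb y :\ x :\ x'|.
  move: dy; rewrite (cardsD1 x) (cardsD1 x' (nb y :\ x)).
  by do 2!case: (_ \in _); rewrite ?add0n ?add1n => // /ltnW // /ltnW.
by case/card_gt0P => z; rewrite !inE => /and3P[]; exists z.
Qed.

Lemma nb_deg2 (G : sgraph) (x y : G) :
  #|nb x| = 2 -> adj x y -> exists2 z, z != y & nb x = [set y; z].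
Proof.
move=> /eqP/cards2P[a [b [ab nx]]]; rewrite -in_nb nx !inE.
case/orP=> /eqP->; first by exists b; rewrite // eq_sym.
by exists a; rewrite // setUC.
Qed.

Lemma nb_deg2_eq (G : sgraph) (x y z : G) :
  #|nb x| == 2 -> adj x y -> adj x z -> y != z -> nb x = [set y; z].
Proof.
move=> /eqP dx xy xz yz; apply/esym/eqP; rewrite eqEcard cards2 yz dx andbT.
by apply/subsetP => t; rewrite !inE => /orP[]/eqP->.
Qed.

Lemma no_deg2_factor (G H : sgraph) (h : H) :
  well_covered (G □ H) -> C3free G -> C4free G -> C3free H ->
  (forall g : G, 1 < #|nb g|) -> (forall k : H, 1 < #|nb k|) -> nontrivial G ->
  #|nb h| = 2 -> False.
Proof.
move=> wc G3 G4 H3 dG dH ntG /eqP/cards2P[h1 [h2 [h12 nh]]].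
have hE (k : H) : adj h k = (k == h1) || (k == h2) by rewrite -in_nb nh !inE.
have hh1 : adj h h1 by rewrite hE eqxx.
have hh2 : adj h h2 by rewrite hE eqxx orbT.
have [k1 hk1 k1h] := other_nb h (dH h1).
have [k2 hk2 k2h] := other_nb h (dH h2).
have [g _] : exists g : G, true by case/card_gt1P: ntG => g _; exists g.
have [g1 [g2 [gg1 gg2 g12]]] := card_gt1P (dG g).
rewrite !in_nb in gg1 gg2.
have [s1 gs1 s1g] := other_nb g (dG g1).
have [s2 gs2 s2g] := other_nb g (dG g2).
have dis s := C4free_path (s := s) G4 gg1 gg2 g12.
(* The further neighbours of [g1] go to layer [h1], those of [g2] to layer [h2]; the two sets are
   disjoint for lack of 4-cycles. This leaves [(g1, h2)] and [(g2, h1)], which are dominated from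
   one layer further out. *)
pose I : {set G □ H} := [set z |
  [|| [&& z.2 == h1, z.1 != g & adj g1 z.1], [&& z.2 == h2, z.1 != g & adj g2 z.1],
      z == (g1, k2) | z == (g2, k1)]].
apply: (no_path_star (g := g) (g1 := g1) (g2 := g2) (h := h) (I := I)) => //.
- apply/independentP => -[a b] [c d]; rewrite cart_adjE !inE /= ?xpair_eqE => A B C.
  by graph_split; first [graph_contra | eauto].
- case=> a b; rewrite cart_adjE !inE /= ?xpair_eqE => A B.
  by graph_split; first [graph_contra | eauto].
- move=> h'; rewrite hE => /orP[] /eqP->.
  + by exists (s1, h1); rewrite ?cart_adjE ?inE /= ?eqxx ?s1g ?gs1 ?orbT.
  + by exists (g1, k2); rewrite ?cart_adjE ?inE /= ?eqxx ?hk2 ?orbT.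
- move=> h'; rewrite hE => /orP[] /eqP->.
  + by exists (g2, k1); rewrite ?cart_adjE ?inE /= ?eqxx ?hk1 ?orbT.
  + by exists (s2, h2); rewrite ?cart_adjE ?inE /= ?eqxx ?s2g ?gs2 ?orbT.
- move=> s /orP[] gs sg.
  + by exists (s, h1); rewrite ?cart_adjE ?inE /= ?eqxx ?sg ?gs ?hh1 ?orbT.
  + by exists (s, h2); rewrite ?cart_adjE ?inE /= ?eqxx ?sg ?gs ?hh2 ?orbT.
Qed.

(** Without 4-cycles, the edges between the two sets form a matching. Any edge of it serves as [s1],
    [s2], and any pair does if there is none. Exchanging [s1] and [s2] then keeps both sets
    independent. *)
Lemma path_match (G : sgraph) (g g1 g2 : G) :
  C3free G -> C4free G -> adj g g1 -> adj g g2 -> g1 != g2 ->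
  nb g1 :\ g != set0 -> nb g2 :\ g != set0 ->
  exists s1 s2, [/\ s1 \in nb g1 :\ g, s2 \in nb g2 :\ g,
    forall t, t \in nb g2 :\ g -> adj s1 t -> t = s2 &
    forall t, t \in nb g1 :\ g -> adj t s2 -> t = s1].
Proof.
move=> G3 G4 gg1 gg2 g12 S1 S2.
have [/existsP[s1 /existsP[s2 /and3P[s1S s2S s12]]]|no_edge] := boolP
  [exists s1, exists s2, [&& s1 \in nb g1 :\ g, s2 \in nb g2 :\ g & adj s1 s2]].
  exists s1, s2; split=> // t tS ts; move: s1S s2S tS; rewrite !inE => *; graph_split.
    apply: (G4 s1 g2) => //; apply/negP => /eqP?; subst.
    by graph_contra.
  apply: (G4 s2 g1); rewrite // 1?adj_sym //; apply/negP => /eqP?; subst.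
  by graph_contra.
have [[s1 s1S] [s2 s2S]] := (set0Pn _ S1, set0Pn _ S2).
by exists s1, s2; split=> // t tS ts; case/negP: no_edge;
  do 2![apply/existsP; eexists]; apply/and3P; split; eassumption.
Qed.

Lemma no_min_deg3_factor (G H : sgraph) (g : G) (h : H) :
  well_covered (G □ H) -> C3free G -> C4free G -> C3free H ->
  (forall g : G, 2 < #|nb g|) -> 1 < #|nb h| -> False.
Proof.
move=> wc G3 G4 H3 dG /card_gt1P[h1 [h2 [hh1 hh2 h12]]].
rewrite !in_nb in hh1 hh2.
have [g1 [g2 [gg1 gg2 g12]]] := card_gt1P (ltnW (dG g)).
rewrite !in_nb in gg1 gg2.
have dS f : adj g f -> 1 < #|nb f :\ g|.
  by move=> gf; have := dG f; rewrite (cardsD1 g) in_nb adj_sym gf.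
have [||s1 [s2 [s1S s2S u1 u2]]] := path_match G3 G4 gg1 gg2 g12.
- by rewrite -card_gt0 ltnW ?dS.
- by rewrite -card_gt0 ltnW ?dS.
have other (x f : G) : adj g f -> exists2 t, t \in nb f :\ g & t != x.
  move=> /dS /card_gt1P[a [b [ya yb ab]]].
  have [ax|ax] := eqVneq a x; last by exists a.
  by exists b; rewrite // -ax eq_sym.
have [t1 t1S t1s] := other s1 g1 gg1.
have [t2 t2S t2s] := other s2 g2 gg2.
have [s1g g1s1] : s1 != g /\ adj g1 s1 by move: s1S; rewrite !inE => /andP.
have [s2g g2s2] : s2 != g /\ adj g2 s2 by move: s2S; rewrite !inE => /andP.
have [t1g g1t1] : t1 != g /\ adj g1 t1 by move: t1S; rewrite !inE => /andP.
have [t2g g2t2] : t2 != g /\ adj g2 t2 by move: t2S; rewrite !inE => /andP.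
have dis s := C4free_path (s := s) G4 gg1 gg2 g12.
pose S1 := nb g1 :\ g; pose S2 := nb g2 :\ g.
(* Layer [h1] receives [S2] with [s2] replaced by [s1]; every other layer adjacent to that of [h]
   receives [S1] with [s1] replaced by [s2]. Each of these layers meets both [S1] and [S2], since
   degree 3 leaves [t1] and [t2], and layers [h1] and [h2] together contain all of both. *)
pose I : {set G □ H} := [set z |
  (z.2 == h1) && ((z.1 == s1) || (z.1 \in S2) && (z.1 != s2)) ||
  [&& adj h z.2, z.2 != h1 & (z.1 == s2) || (z.1 \in S1) && (z.1 != s1)]].
have S1E s : (s \in S1) = (s != g) && adj g1 s by rewrite !inE.
have S2E s : (s \in S2) = (s != g) && adj g2 s by rewrite !inE.
apply: (no_path_star (g := g) (g1 := g1) (g2 := g2) (h := h) (I := I)) => //.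
- have i1 a c : (a == s1) || (a \in S2) && (a != s2) ->
      (c == s1) || (c \in S2) && (c != s2) -> adj a c -> False.
    case/orP=> [/eqP->|/andP[aS /eqP as2]];
      case/orP=> [/eqP->|/andP[cS /eqP cs2]] ac.
    - by rewrite adj_irr in ac.
    - exact/cs2/u1.
    - by apply/as2/u1; rewrite // adj_sym.
    - by move: aS cS; rewrite !S2E => *; graph_split; graph_contra.
  have i2 a c : (a == s2) || (a \in S1) && (a != s1) ->
      (c == s2) || (c \in S1) && (c != s1) -> adj a c -> False.
    case/orP=> [/eqP->|/andP[aS /eqP as1]];
      case/orP=> [/eqP->|/andP[cS /eqP cs1]] ac.
    - by rewrite adj_irr in ac.
    - by apply/cs1/u2; rewrite // adj_sym.
    - exact/as1/u2.
    - by move: aS cS; rewrite !S1E => *; graph_split; graph_contra.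
  apply/independentP => -[a b] [c d]; rewrite cart_adjE !inE /=.
  case/orP=> [/andP[/eqP-> A]|/and3P[hb bh1 A]];
    case/orP=> [/andP[/eqP-> B]|/and3P[hd dh1 B]];
    case/orP=> /andP[/eqP E C]; subst; try graph_contra.
  + by apply: (i1 a c); rewrite ?S2E.
  + by apply: (i2 a c); rewrite ?S1E.
- case=> a b; rewrite cart_adjE !inE /= => A B.
  graph_split; graph_contra.
- move=> h' hh'; have [->|h'h1] := eqVneq h' h1.
    by exists (s1, h1); rewrite ?cart_adjE ?inE /= ?eqxx // g1s1 orbT.
  by exists (t1, h'); rewrite ?cart_adjE ?inE /= ?eqxx ?hh' ?h'h1 ?S1E ?g1t1 ?t1g ?t1s ?orbT.
- move=> h' hh'; have [->|h'h1] := eqVneq h' h1.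
    by exists (t2, h1); rewrite ?cart_adjE ?inE /= ?eqxx ?S2E ?g2t2 ?t2g ?t2s ?orbT.
  by exists (s2, h'); rewrite ?cart_adjE ?inE /= ?eqxx ?hh' ?h'h1 ?g2s2 ?orbT.
- move=> s gs sg.
  case/orP: gs => gs.
    have [->|ss1] := eqVneq s s1.
      by exists (s1, h1); rewrite ?cart_adjE ?inE /= ?eqxx ?hh1.
    exists (s, h2); rewrite ?cart_adjE ?inE /= ?eqxx ?hh2 //.
    by rewrite eq_sym h12 sg gs ss1 !orbT.
  have [->|ss2] := eqVneq s s2.
    exists (s2, h2); rewrite ?cart_adjE ?inE /= ?eqxx ?hh2 //.
    by rewrite eq_sym h12 !orbT.
  by exists (s, h1); rewrite ?cart_adjE ?inE /= ?eqxx ?hh1 ?sg ?gs ?ss2 ?orbT.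
Qed.

(** * Greedy choice of independent dominating sets *)

(** If [W] does not yet dominate [u], each [w] in [W] excludes at most one vertex of [nb u :&: X],
    its common neighbour with [u], so some vertex can be added. *)
Lemma greedy_step (G : sgraph) (X W : {set G}) (u : G) :
  C4free G -> independent W -> W \subset X -> u \notin X -> #|W| < #|nb u :&: X| ->
  exists W' : {set G}, [/\ independent W', W \subset W', W' \subset X,
    #|W'| <= #|W|.+1 & exists2 w, w \in W' & adj u w].
Proof.
move=> G4 iW sWX uX ltW.
have [/existsP[w /andP[wW uw]]|/existsPn no] := boolP [exists w, (w \in W) && adj u w].
  by exists W; split=> //; exists w.
(* The common neighbour of [u] and [w]; the default occurs only if there is none, and then nothing
   is excluded. *)
pose f w := odflt u [pick y | adj u y && adj w y].
have /subsetPn[y] : ~~ (nb u :&: X \subset f @: W).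
  by apply: contraL ltW => /subset_leq_card; rewrite -leqNgt => /leq_trans; apply;
    apply: leq_imset_card.
rewrite !inE => /andP[uy yX] yf.
have Wy w : w \in W -> ~~ adj w y.
  move=> wW; apply: contra yf => wy; apply/imsetP; exists w => //.
  rewrite /f; case: pickP => [z /andP[uz wz]|/(_ y)]; last by rewrite uy wy.
  by apply: (G4 u w) => //; apply: contraNneq uX => ->; apply: (subsetP sWX).
exists (y |: W); split.
- apply/independentP => a b; rewrite !inE => /predU1P[->|aW] /predU1P[->|bW].
  + by rewrite adj_irr.
  + by rewrite adj_sym; apply/negP/Wy.
  + by apply/negP/Wy.
  + exact: (independentP _ iW).
- exact: subsetUr.
- by rewrite subUset sub1set yX.
- by rewrite cardsU1 -add1n leq_add2r leq_b1.
- by exists y; rewrite // !inE eqxx.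
Qed.

(** Each step adds at most one vertex, so before each step [W] has fewer than [n] vertices. *)
Lemma greedy_seq (G : sgraph) (X : {set G}) (us : seq G) (n : nat) :
  C4free G -> size us <= n -> {in us, forall u, u \notin X /\ n <= #|nb u :&: X|} ->
  exists W : {set G}, [/\ independent W, W \subset X, #|W| <= size us &
    {in us, forall u, exists2 w, w \in W & adj u w}].
Proof.
move=> G4; elim: us => [_ _|u us IHus /= us_n usP].
  by exists set0; rewrite sub0set cards0; split=> //; apply/independentP => x y; rewrite inE.
have [||W [iW sWX cW domW]] := IHus; first exact: ltnW.
  by move=> x xus; apply: usP; rewrite inE xus orbT.
have [uX nu] := usP u (mem_head _ _).
have [|W' [iW' sWW' sWX' cW' domu]] := greedy_step G4 iW sWX uX.
  exact: leq_ltn_trans cW (leq_trans us_n nu).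
exists W'; split=> //; first exact: leq_trans cW' _.
move=> x; rewrite inE => /predU1P[->//|/domW[w wW xw]].
by exists w; rewrite // (subsetP sWW').
Qed.

(* Each vertex already chosen excludes at most one neighbour of [u], since there
   are no 4-cycles; [u0] is served last. *)
Lemma greedy_dominating (G : sgraph) (X U : {set G}) (u0 : G) :
  C4free G -> u0 \in U -> #|U| <= #|nb u0 :&: X| ->
  {in U, forall u, u \notin X /\ #|U| <= #|nb u :&: X|.+1} ->
  exists W : {set G}, [/\ independent W, W \subset X &
    {in U, forall u, exists2 w, w \in W & adj u w}].
Proof.
move=> G4 u0U cu0 UP; have cU : #|U| = #|U :\ u0|.+1 by rewrite (cardsD1 u0) u0U.
have [||W [iW sWX cW domW]] := @greedy_seq G X (enum (U :\ u0)) #|U :\ u0| G4.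
- by rewrite -cardE.
- by move=> u; rewrite mem_enum !inE => /andP[_ /UP]; rewrite cU ltnS.
rewrite -cardE in cW.
have [|W' [iW' sWW' sWX' _ domu0]] := greedy_step G4 iW sWX (UP u0 u0U).1.
  by rewrite (leq_ltn_trans cW) // -cU.
exists W'; split=> // u uU; have [->//|uu0] := eqVneq u u0.
have [|w wW uw] := domW u; first by rewrite mem_enum !inE uu0.
by exists w; rewrite // (subsetP sWW').
Qed.

(** [nb u] meets [nb g] only in [f], misses [nb f], and meets [nb f'] at most once: hence a loss of
    at most 2. *)
Lemma card_nb_outside (G : sgraph) (g f f' u : G) :
  C3free G -> C4free G -> adj g f -> adj g f' -> f != f' -> adj f u -> u != g ->
  #|nb u| <= #|nb u :&: ~: (nb g :|: nb f :|: nb f')|.+2.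
Proof.
move=> G3 G4 gf gf' ff' fu ug.
have le1 : #|nb u :&: nb f'| <= 1.
  rewrite leqNgt; apply/card_gt1P => -[x [y [xS yS /negP]]]; apply.
  move: xS yS; rewrite !inE => /andP[ux fx] /andP[uy fy].
  apply/eqP; apply: (G4 u f') => //.
  by apply/negP => /eqP ?; subst; graph_contra.
rewrite -(cardsID (~: (nb g :|: nb f :|: nb f')) (nb u)) -addn2 leq_add2l.
apply: (@leq_trans #|f |: (nb u :&: nb f')|); last first.
  by rewrite cardsU1; apply: (@leq_add _ _ 1 1); rewrite ?leq_b1.
apply/subset_leq_card/subsetP => y; rewrite !inE negbK => /andP[H uy]; move: H.
rewrite uy -orbA => /or3P[gy|fy|->]; last by rewrite orbT.
  by apply/orP; left; apply/eqP; apply: (G4 g u); rewrite // 1?adj_sym // eq_sym.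
by graph_contra.
Qed.

(** * The prism over a graph *)

Section Prism.
Variables (G H : sgraph) (h h' : H).
Hypotheses (wc : well_covered (G □ H)) (G3 : C3free G) (G4 : C4free G).
Hypotheses (hE : forall k, adj h k = (k == h')) (h'E : forall k, adj h' k = (k == h)).
Hypothesis (dG : forall g : G, 1 < #|nb g|).

(* [T] is placed in the layer opposite to the path, [W] in the layer of the path. *)
Lemma prism_path (g g1 g2 : G) (T W : {set G}) :
  adj g g1 -> adj g g2 -> g1 != g2 -> independent T -> independent W ->
  [disjoint T & W] -> g \notin T -> (forall w, w \in W -> adj g w -> False) ->
  (exists2 t, t \in T & adj g1 t) -> (exists2 t, t \in T & adj g2 t) ->
  (forall s, adj g1 s || adj g2 s -> s != g ->
     s \in T \/ exists2 w, w \in W & adj s w) ->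
  False.
Proof.
move=> gg1 gg2 g12 /independentP iT /independentP iW dTW gT gW [t1 t1T g1t1]
  [t2 t2T g2t2] dom.
have hh' : h != h' by rewrite adj_neq // hE.
pose I : {set G □ H} := [set z | (z.2 == h') && (z.1 \in T) ||
  (z.2 == h) && (z.1 \in W)].
have TW a : a \in T -> a \in W -> False by move=> /(disjointFr dTW) ->.
apply: (no_path_star (g := g) (g1 := g1) (g2 := g2) (h := h) (I := I)) => //.
- apply/independentP => -[a b] [c d]; rewrite cart_adjE !inE /= => A B C.
  by graph_split; first [graph_contra | eauto].
- case=> a b; rewrite cart_adjE !inE /= => A B.
  graph_split; first [graph_contra | eauto].
- move=> k; rewrite hE => /eqP->; exists (t1, h') => //;
    by rewrite ?cart_adjE ?inE /= ?eqxx ?t1T ?g1t1 ?orbT.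
- move=> k; rewrite hE => /eqP->; exists (t2, h') => //;
    by rewrite ?cart_adjE ?inE /= ?eqxx ?t2T ?g2t2 ?orbT.
- move=> s gs sg; have [sT|[w wW sw]] := dom s gs sg.
    by exists (s, h'); rewrite ?cart_adjE ?inE /= ?eqxx ?sT ?hE ?eqxx.
  by exists (w, h); rewrite ?cart_adjE ?inE /= ?eqxx ?wW ?sw ?orbT.
Qed.

(** Obstruction centred at [(v, h)] with one neighbour in each direction, [(u, h)] and [(v, h')].
    The set [T] is placed in the layer of [h']; its vertices from [nb u :\ v] dominate their own
    copies in the layer of [h]. *)
Lemma prism_star (v u : G) (T : {set G}) :
  adj v u -> independent T -> v \notin T -> nb u :\ v \subset T ->
  (forall y, adj v y -> exists2 t, t \in T & adj y t) ->
  False.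
Proof.
move=> vu /independentP iT vT sT dom.
have hh' : adj h h' by rewrite hE.
pose I : {set G □ H} := setX T [set h'].
apply: (well_covered_swap (x := (v, h) : G □ H) (a := (u, h)) (b := (v, h')) (I := I)) => //.
- by rewrite cart_adjE eqxx vu orbT.
- by rewrite cart_adjE eqxx hh'.
- by rewrite xpair_eqE eq_sym (negPf (adj_neq vu)).
- by rewrite cart_adjE eq_sym (negPf (adj_neq vu)) (negPf (adj_neq hh')).
- apply/independentP => -[a b] [c d]; rewrite cart_adjE !inE /= ?xpair_eqE => A B C.
  by graph_split; first [graph_contra | eauto].
- case=> a b; rewrite !cart_adjE xpair_eqE hE h'E.
  case/orP=> /orP[] /andP[/eqP<- ab] B.
  + have [t tT ut] := dom u vu; rewrite (eqP ab).
    by exists (t, h'); rewrite ?cart_adjE ?inE /= ?eqxx ?tT ?ut ?orbT.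
  + exists (a, h'); rewrite ?cart_adjE ?inE /= ?eqxx ?hh' //.
    by rewrite andbT (subsetP sT) // !inE ab andbT; move: B; rewrite eqxx andbT.
  + by move: B; rewrite eqxx ab.
  + have [t tT at_] := dom a ab.
    by exists (t, h'); rewrite ?cart_adjE ?inE /= ?eqxx ?tT ?at_ ?orbT.
Qed.

(** * Prisms over graphs with vertices of degree two *)

(** Otherwise [t] together with the neighbours of [u] other than [v] is independent and dominates
    both neighbours of [v], against [prism_star]. *)
Lemma deg2_match (v u w t : G) :
  nb v = [set u; w] -> adj w t -> t != v ->
  exists s, [/\ adj u s, s != v & adj t s].
Proof.
move=> nv wt tv.
have vE y : adj v y = (y == u) || (y == w) by rewrite -in_nb nv !inE.
have vu : adj v u by rewrite vE eqxx.
have vw : adj v w by rewrite vE eqxx orbT.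
have [/existsP[s /and3P[us sv ts]]|/existsPn no] :=
  boolP [exists s, [&& adj u s, s != v & adj t s]]; first by exists s.
have tS s : adj u s -> s != v -> ~~ adj t s.
  by move=> us sv; have := no s; rewrite us sv.
have [s us sv] := other_nb v (dG u).
case: (@prism_star v u (t |: (nb u :\ v))) => //.
- apply/independentP => a b; rewrite !inE.
  case/predU1P=> [->|/andP[av ua]]; case/predU1P=> [->|/andP[bv ub]] ab;
    try graph_contra.
  + by have := tS b ub bv; rewrite ab.
  + by have := tS a ua av; rewrite adj_sym ab.
- by rewrite !inE eqxx eq_sym (negPf tv).
- exact: subsetUr.
- move=> y; rewrite vE => /orP[]/eqP->; first by exists s; rewrite // !inE us sv orbT.
  by exists t; rewrite // !inE eqxx.
Qed.

(** By [deg2_match] at [v], every neighbour of [w] other than [v] is adjacent to [s], the only match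
    available; for lack of 4-cycles there is just one, [t]. Matching at [u] and at [w] leaves no
    further neighbours of [s] and [t], and connectedness makes the 5-cycle all of [G]. *)
Lemma adj_deg2_C5 (v u : G) : connected G -> #|nb v| = 2 -> #|nb u| = 2 -> adj v u ->
  exists w s t, [/\ nb v = [set u; w], nb u = [set v; s], nb s = [set u; t],
    nb t = [set s; w] & nb w = [set v; t]] /\ uniq [:: v; u; s; t; w] /\ [set v; u; s; t; w] = setT.
Proof.
move=> cG dv du vu; have [w wu nv] := nb_deg2 dv vu.
have uv : adj u v by rewrite adj_sym.
have [s sv nu] := nb_deg2 du uv.
have vw : adj v w by rewrite -in_nb nv !inE eqxx orbT.
have us : adj u s by rewrite -in_nb nu !inE eqxx orbT.
have uE x : adj u x -> x != v -> x = s.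
  by rewrite -in_nb nu !inE => /orP[] /eqP-> //; rewrite eqxx.
have vE x : adj v x -> x != u -> x = w.
  by rewrite -in_nb nv !inE => /orP[] /eqP-> //; rewrite eqxx.
have ws x : adj w x -> x != v -> adj x s.
  by move=> wx /(deg2_match nv wx)[y [uy /(uE _ uy)-> ]].
have [t wt tv] := other_nb v (dG w).
have ts := ws t wt tv.
have nw : nb w = [set v; t].
  apply/setP => x; rewrite !inE; apply/idP/idP => [wx|/orP[]/eqP-> //]; last by rewrite adj_sym.
  have [//|xv /=] := eqVneq x v; apply/eqP; apply: (@G4 w s) => //; last 2 first.
  - by rewrite adj_sym ws.
  - by rewrite adj_sym.
  by apply/negP => /eqP ?; subst; graph_contra.
have ns : nb s = [set u; t].
  apply/setP => y; rewrite !inE; apply/idP/idP => [sy|/orP[]/eqP->]; last first.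
  - by rewrite adj_sym.
  - by rewrite adj_sym.
  have [//|yu /=] := eqVneq y u.
  have [z [vz zu yz]] := deg2_match nu sy yu.
  rewrite (vE z vz zu) adj_sym -in_nb nw !inE in yz.
  by case/predU1P: yz => // ?; subst; graph_contra.
have nt : nb t = [set s; w].
  apply/setP => y; rewrite !inE; apply/idP/idP => [ty|/orP[]/eqP-> //]; last by rewrite adj_sym.
  have [|yw /=] := eqVneq y w; first by rewrite orbT.
  have [z [vz zw yz]] := deg2_match nw ty yw.
  move: vz; rewrite -in_nb nv !inE (negPf zw) orbF => /eqP zu; subst z.
  move: yz; rewrite adj_sym -in_nb nu !inE orbF => /predU1P[?|//]; subst.
  by graph_contra.
exists w, s, t; split; first by split.
split.
  rewrite /= !inE !negb_or (adj_neq vu) (adj_neq vw) (adj_neq us) eq_sym sv.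
  rewrite (eq_sym v) tv (eq_sym u w) wu (eq_sym s t) (adj_neq ts).
  rewrite (eq_sym t w) (adj_neq wt) /=.
  by rewrite !andbT; apply/andP; split; apply/negP => /eqP ?; subst; graph_contra.
apply: (connected_closed (x := v) cG) => [|y z]; rewrite !inE ?eqxx //.
by rewrite -!orbA => /or4P[|||/orP[]] /eqP->; rewrite -in_nb ?nv ?nu ?ns ?nt ?nw !inE => /orP[]->; rewrite ?orbT.
Qed.

Section IndependentDeg2.
Hypothesis deg2_indep : forall x y : G, #|nb x| == 2 -> #|nb y| == 2 -> adj x y -> False.

Lemma deg2_neq3 (x : G) : (#|nb x| != 2) = (2 < #|nb x|).
Proof. by rewrite neq_ltn ltnNge dG. Qed.

(** If both had degree at least 3, [prism_path] would apply to the path [a], [u], [v]: the opposite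
    layer holds [w] and the neighbours of [a] except [u] and [b], while [b] is dominated in the
    layer of the path by a third neighbour [c]. *)
Lemma match_deg2 (v u w a b : G) :
  nb v = [set u; w] -> u != w -> adj u a -> a != v -> adj w b -> b != v -> adj a b ->
  (#|nb a| == 2) || (#|nb b| == 2).
Proof.
move=> nv uw ua av wb bv ab; apply/negPn/negP; rewrite negb_or !deg2_neq3 => /andP[da db].
have vu : adj v u by rewrite -in_nb nv !inE eqxx.
have vw : adj v w by rewrite -in_nb nv !inE eqxx orbT.
have bw : b != u by apply/negP => /eqP ?; subst; graph_contra.
have [c [bc ca cw]] := third_nb a w db.
have [s [as_ sb su]] := third_nb b u da.
have uv : adj u v by rewrite adj_sym.
have wT x : adj a x -> x != b -> adj w x -> False.
  move=> ax /negP xb wx; apply: xb; apply/eqP; apply: (@G4 a w) => //.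
  by apply/negP => /eqP ?; subst; graph_contra.
apply: (@prism_path u a v (w |: (nb a :\ b :\ u)) [set c]) => //.
- apply/independentP => x y; rewrite !inE.
  case/predU1P=> [->|/and3P[xu xb ax]]; case/predU1P=> [->|/and3P[yu yb ay]] xy;
    try graph_contra.
  + exact: wT xy.
  + by apply: (wT x) => //; rewrite adj_sym.
- by apply/independentP => x y; rewrite !inE => /eqP-> /eqP->; rewrite adj_irr.
- rewrite disjoint_sym disjoints1 !inE negb_or cw /= !negb_and.
  by apply/orP; right; apply/orP; right; apply/negP => ac; graph_contra.
- by rewrite !inE eqxx (negPf uw).
- move=> x; rewrite inE => /eqP-> uc; case/negP: ca; apply/eqP.
  by apply: (@G4 b u) => //; rewrite adj_sym.
- by exists s; rewrite // !inE as_ sb su orbT.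
- by exists w; rewrite // !inE eqxx.
- move=> x /orP[ax|vx] xu.
    have [->|xb] := eqVneq x b; first by right; exists c; rewrite // inE.
    by left; rewrite !inE ax xb xu orbT.
  by left; move: vx; rewrite -in_nb nv !inE (negPf xu) => /= ->.
Qed.

(** A neighbour [b1] of [w] has a match [a1] of degree 2, hence is not of degree 2 itself and has a
    third neighbour [c]. Matching at [a1] gives a neighbour [y] of [u] adjacent to [c], and matching
    at [v] a neighbour [b] of [w] adjacent to [y]. As [y] has degree 2, [b = c], and [w], [b1], [c]
    form a triangle. *)
Lemma not_all_deg2 (v u w : G) :
  #|nb v| == 2 -> nb v = [set u; w] -> u != w ->
  (forall a, adj u a -> a != v -> #|nb a| == 2) -> False.
Proof.
move=> dv nv uw all2.
have vu : adj v u by rewrite -in_nb nv !inE eqxx.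
have vw : adj v w by rewrite -in_nb nv !inE eqxx orbT.
have [b1 wb1 b1v] := other_nb v (dG w).
have [a1 [ua1 a1v b1a1]] := deg2_match nv wb1 b1v.
have da1 := all2 a1 ua1 a1v.
have db1 : #|nb b1| != 2 by apply/negP => /deg2_indep /(_ da1); apply.
rewrite deg2_neq3 in db1.
have [c [b1c ca1 cw]] := third_nb a1 w db1.
have na1 : nb a1 = [set u; b1].
  apply: nb_deg2_eq; rewrite // 1?adj_sym //.
  by apply/negP => /eqP ?; subst; graph_contra.
have [y [uy ya1 cy]] := deg2_match na1 b1c ca1.
have cu : c != u.
  by apply/negP => /eqP ?; subst; graph_contra.
have [?|yv] := eqVneq y v.
  by subst y; move: cy; rewrite adj_sym -in_nb nv !inE (negPf cu) (negPf cw).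
have [b [wb bv yb]] : exists b, [/\ adj w b, b != v & adj y b].
  by apply: (@deg2_match v w u); rewrite // nv setUC.
have [|z zu ny] := @nb_deg2 _ y u (eqP (all2 y uy yv)); first by rewrite adj_sym.
have yE x' : adj y x' -> x' != u -> x' = z.
  by rewrite -in_nb ny !inE => /predU1P[->|/eqP//]; rewrite eqxx.
have bu : b != u by apply/negP => /eqP ?; subst; graph_contra.
have ? : c = b by rewrite (yE c) 1?(yE b) // adj_sym.
by subst; graph_contra.
Qed.

(** The match [b] of [a] has degree 2 and can replace [v]: matching at [b] pairs [b1] with a
    neighbour [y] of [a], and [match_deg2] at [b] gives [y] degree 2. *)
Lemma deg2_outside (v u w a b1 : G) :
  #|nb v| == 2 -> nb v = [set u; w] -> u != w ->
  adj u a -> a != v -> #|nb a| != 2 -> adj w b1 -> b1 != v -> #|nb b1| != 2 ->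
  exists y, [/\ #|nb y| == 2, ~~ adj u y, ~~ adj w y & adj a y].
Proof.
move=> dv nv uw ua av da wb1 b1v db1.
have vu : adj v u by rewrite -in_nb nv !inE eqxx.
have vw : adj v w by rewrite -in_nb nv !inE eqxx orbT.
have [b [wb bv ab]] : exists b, [/\ adj w b, b != v & adj a b].
  by apply: (@deg2_match v w u); rewrite // nv setUC.
have db : #|nb b| == 2.
  by have := match_deg2 nv uw ua av wb bv ab; rewrite (negPf da).
have aw : a != w by apply/negP => /eqP ?; subst; graph_contra.
have nb_b : nb b = [set a; w] by apply: nb_deg2_eq; rewrite // adj_sym.
have b1b : b1 != b by apply: contraNneq db1 => ->.
have [y [ay yb b1y]] := deg2_match nb_b wb1 b1b.
exists y; split=> //.
- have yb1 : adj y b1 by rewrite adj_sym.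
  by have := match_deg2 nb_b aw ay yb wb1 b1b yb1; rewrite (negPf db1) orbF.
- by apply/negP => uy; graph_contra.
- apply/negP => wy; case/negP: yb; apply/eqP; exact: (@G4 a w).
Qed.

(** All vertices of degree 2 are used: those other than [v] that are adjacent to [u] or [w] go to
    the opposite layer, the rest to the layer of the path, where [deg2_outside] shows that they
    dominate what is left. *)
Lemma no_deg2_prism (v : G) : #|nb v| == 2 -> False.
Proof.
move=> dv.
have [u [w [uw nv]]] := cards2P _ dv.
have vE y : adj v y = (y == u) || (y == w) by rewrite -in_nb nv !inE.
have vu : adj v u by rewrite vE eqxx.
have vw : adj v w by rewrite vE eqxx orbT.
have nv' : nb v = [set w; u] by rewrite setUC.
have wu : w != u by rewrite eq_sym.
have not2 (x y : G) : nb v = [set x; y] -> x != y ->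
    exists a, [/\ adj x a, a != v & #|nb a| != 2].
  move=> nxy xy; have [/existsP[a /and3P[? ? ?]]|/existsPn no] :=
    boolP [exists a, [&& adj x a, a != v & #|nb a| != 2]]; first by exists a.
  case: (not_all_deg2 dv nxy xy) => a xa av.
  by have := no a; rewrite xa av /= negbK.
have [a2 [ua2 a2v da2]] := not2 u w nv uw.
have [b1 [wb1 b1v db1]] := not2 w u nv' wu.
(* The match of a vertex whose degree is not 2 has degree 2, so [T] meets the neighbourhoods of both
   [u] and [w]. *)
have hit (x y z : G) : nb v = [set x; y] -> x != y -> adj y z -> z != v -> #|nb z| != 2 ->
    exists t, [/\ #|nb t| == 2, adj x t & t != v].
  move=> nxy xy yz zv dz; have [t [xt tv zt]] := deg2_match nxy yz zv.
  exists t; split=> //.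
  have tz : adj t z by rewrite adj_sym.
  by have := match_deg2 nxy xy xt tv yz zv tz; rewrite (negPf dz) orbF.
have [t1 [dt1 ut1 t1v]] := hit u w b1 nv uw wb1 b1v db1.
have [t2 [dt2 wt2 t2v]] := hit w u a2 nv' wu ua2 a2v da2.
pose T := [set x : G | [&& #|nb x| == 2, adj u x || adj w x & x != v]].
apply: (@prism_path v u w T [set x | (#|nb x| == 2) && (x \notin T)]) => //.
- apply/independentP => x y; rewrite !inE => /andP[dx _] /andP[dy _]; exact: deg2_indep.
- apply/independentP => x y; rewrite !inE => /andP[dx _] /andP[dy _]; exact: deg2_indep.
- by rewrite disjoints_subset; apply/subsetP => x xT; rewrite !inE in xT *; rewrite xT andbF.
- by rewrite !inE eqxx !andbF.
- move=> x; rewrite inE => /andP[dx _]; exact: deg2_indep.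
- by exists t1; rewrite // !inE dt1 ut1.
- by exists t2; rewrite // !inE dt2 wt2 orbT.
- move=> s us sv; have [ds|ds] := boolP (#|nb s| == 2).
    by left; rewrite !inE ds us.
  right; case/orP: us => us.
    have [y [dy uy wy sy]] := deg2_outside dv nv uw us sv ds wb1 b1v db1.
    by exists y; rewrite // !inE dy (negPf uy) (negPf wy).
  have [y [dy wy uy sy]] := deg2_outside dv nv' wu us sv ds ua2 a2v da2.
  by exists y; rewrite // !inE dy (negPf uy) (negPf wy).
Qed.

End IndependentDeg2.

(** * Prisms over graphs of minimum degree at least three *)

(* [T] takes everything in the two neighbourhoods but [U], and [W] must dominate
   [U]: at most [#|nb v| - 1] vertices, each with at least [#|nb v| - 2] neighbours
   available for [W]. The greedy choice is one short, and each of the two ways for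
   [s] to violate the conclusion supplies the missing unit. *)
Lemma min_deg_match (v g g1 s : G) :
  (forall x : G, #|nb v| <= #|nb x|) -> 2 < #|nb v| ->
  adj g v -> adj g g1 -> g1 != v -> adj v s -> s != g ->
  (exists t, [/\ adj g1 t, t != g & adj s t]) /\ #|nb s| <= #|nb v|.
Proof.
move=> min_v dv gv gg1 g1v vs sg.
pose matched x := [exists t, [&& adj g1 t, t != g & adj x t]].
suff: matched s && (#|nb s| <= #|nb v|).
  by case/andP=> /existsP[t /and3P[]]; split=> //; exists t.
apply/negPn/negP; rewrite negb_and -ltnNge => bad.
have vg : adj v g by rewrite adj_sym.
(* [s2] is put into [T] to dominate [v], so its match [s1] must stay out of [T]. If [s2] has no
   match, [s1] is arbitrary. *)
have [s2 [vs2 s2g s2s]] := third_nb g s dv.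
have [s1 [g1s1 s1g s1P]] : exists s1, [/\ adj g1 s1, s1 != g &
    forall t, adj g1 t -> t != g -> adj s2 t -> t = s1].
  have [/existsP[s1 /and3P[g1s1 s1g s2s1]]|/existsPn no] := boolP (matched s2).
    exists s1; split=> // t g1t tg s2t; apply: (@G4 s2 g1) => //.
    by apply/negP => /eqP ?; subst; graph_contra.
  have [s1 g1s1 s1g] := other_nb g (dG g1); exists s1; split=> // t g1t tg s2t.
  by have := no t; rewrite g1t tg s2t.
pose U := s1 |: [set x | [&& adj v x, x != g, x != s2 & matched x]].
pose T := [set x | [&& adj g1 x, x != g & x != s1]] :|:
  [set x | [&& adj v x, x != g & (x == s2) || ~~ matched x]].
pose X := ~: (nb g :|: nb g1 :|: nb v).
have nX u : adj g1 u || adj v u -> u != g -> #|nb u| <= #|nb u :&: X|.+2.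
  move=> /orP[] fu ug.
    exact: card_nb_outside G3 G4 gg1 gv g1v fu ug.
  have := card_nb_outside G3 G4 gv gg1 _ fu ug.
  by rewrite eq_sym -setUA [nb v :|: _]setUC setUA; apply.
have cU : #|U| < #|nb v|.
  rewrite /U cardsU1 (cardsD1 g (nb v)) in_nb vg (cardsD1 s2 (nb v :\ g)).
  rewrite !inE s2g vs2 /= !add1n ltnS -add1n.
  apply: leq_add; rewrite ?leq_b1 // subset_leq_card //; apply/subsetP => x.
  by rewrite !inE => /and4P[-> -> ->].
(* If [s] is matched, it lies in [U] and its larger degree gives the spare neighbour. If not, [U]
   lacks [s] and is smaller by one, so that [s1] can be served last. *)
have [u0 u0U cu0] : exists2 u0, u0 \in U & #|U| <= #|nb u0 :&: X|.
  have [ms|nms] := boolP (matched s).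
    exists s; first by rewrite !inE vs sg (eq_sym s s2) s2s ms orbT.
    rewrite ms /= in bad; rewrite -2!ltnS.
    by apply: leq_trans (leq_ltn_trans cU bad) (nX s _ sg); rewrite vs orbT.
  exists s1; first by rewrite !inE eqxx.
  rewrite -2!ltnS; apply: (@leq_trans #|nb v|); last first.
    by apply: leq_trans (min_v s1) (nX s1 _ s1g); rewrite g1s1.
  rewrite /U cardsU1 (cardsD1 g (nb v)) in_nb vg (cardsD1 s2 (nb v :\ g)).
  rewrite (cardsD1 s (nb v :\ g :\ s2)) !inE s2g vs2 (eq_sym s s2) s2s sg vs /=.
  rewrite !add1n !ltnS -add1n.
  apply: leq_add; rewrite ?leq_b1 // subset_leq_card //; apply/subsetP => x.
  rewrite !inE => /and4P[-> -> -> mx]; rewrite !andbT.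
  by apply: contraNneq nms => <-.
have UE u : u \in U -> (adj g1 u || adj v u) && (u != g).
  by rewrite !inE => /predU1P[->|/and4P[-> ->]]; rewrite ?g1s1 ?s1g ?orbT.
have [|W [iW sWX domW]] := greedy_dominating G4 u0U cu0.
  move=> u /[dup] uU /UE/andP[gu ug]; split.
    by rewrite !inE negbK; case/orP: gu => ->; rewrite !orbT.
  by rewrite -ltnS (leq_trans cU) // (leq_trans (min_v u)) // nX.
have WX w : w \in W -> [/\ ~~ adj g w, ~~ adj g1 w & ~~ adj v w].
  by move/(subsetP sWX); rewrite !inE !negb_or -andbA => /and3P.
have cross x y : adj g1 x -> x != g -> x != s1 -> (y == s2) || ~~ matched y ->
    adj x y -> False.
  move=> g1x xg xs1 /predU1P[->|/existsPn no] xy.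
    by case/eqP: xs1; apply: s1P; rewrite // adj_sym.
  by have := no x; rewrite g1x xg adj_sym xy.
apply: (@prism_path g g1 v T W) => //.
- apply/independentP => x y; rewrite !inE.
  case/orP=> /and3P[fx xg xP]; case/orP=> /and3P[fy yg yP] xy; try graph_contra.
  + exact: (cross x y).
  + by apply: (cross y x); rewrite // adj_sym.
- rewrite disjoint_sym disjoints_subset; apply/subsetP => w /WX[_ /negPf a /negPf b].
  by rewrite !inE a b.
- by rewrite !inE eqxx !andbF.
- by move=> w /WX[/negP].
- have [t [g1t tg ts1]] := third_nb g s1 (leq_trans dv (min_v g1)).
  by exists t; rewrite // !inE g1t tg ts1.
- by exists s2; rewrite // !inE vs2 s2g eqxx orbT.
- move=> x gx xg; have [xU|xU] := boolP (x \in U); first by right; apply: domW.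
  left; move: xU gx; rewrite !inE xg negb_or /= => /andP[->].
  by rewrite !andbT; case: (adj g1 x) => //= + vx; rewrite vx /= negb_and negbK.
Qed.

(** At a vertex [v] of minimum degree, [min_deg_match] shows that the neighbours of [v] have minimum
    degree too, so it applies again with these in the role of its [v]. Hence [nb g3 :\ v] dominates
    the further neighbours of [g1] and [g2]. *)
Lemma no_min_deg3_prism (v : G) : (forall g : G, 2 < #|nb g|) -> False.
Proof.
move=> d3; case: (@arg_minnP _ v xpredT (fun x => #|nb x|)) => // {}v _ minv.
have min_v (x : G) : #|nb v| <= #|nb x| by apply: minv.
have dv := d3 v.
have min_nb (y x : G) : adj v y -> #|nb y| <= #|nb x|.
  move=> vy; have [g vg gy] := other_nb y (dG v).
  have gv : adj g v by rewrite adj_sym.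
  have [g1 gg1 g1v] := other_nb v (dG g).
  rewrite eq_sym in gy.
  by have [_ /leq_trans] := min_deg_match min_v dv gv gg1 g1v vy gy; apply.
have [g1 [g2 [g3 [[]]]]] := card_gt2P dv; rewrite !in_nb => vg1 vg2 vg3 [g12 g23 g31].
have sat f s : adj v f -> g3 != f -> adj f s -> s != v ->
    exists2 w, w \in nb g3 :\ v & adj s w.
  move=> vf fg3 fs sv.
  have [|[t [g3t tv st]] _] := min_deg_match _ (d3 f) vf vg3 fg3 fs sv.
    by move=> x; apply: min_nb.
  by exists t; rewrite // !inE tv.
have ne f : nb f :\ v != set0.
  by have [t ft tv] := other_nb v (dG f); apply/set0Pn; exists t; rewrite !inE ft tv.
have [s1 [s2 [s1S s2S u1 _]]] := path_match G3 G4 vg1 vg2 g12 (ne _) (ne _).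
have [s1v g1s1] : s1 != v /\ adj g1 s1 by move: s1S; rewrite !inE => /andP.
have s1P t : adj g2 t -> t != v -> adj s1 t -> t = s2.
  by move=> g2t tv; apply: u1; rewrite !inE g2t tv.
have dis x y z : adj v x -> adj v y -> x != y -> adj x z -> adj y z -> z != v -> False.
  exact: C4free_path.
(* The first set only has to dominate [g1] and [g2]; it is independent by the choice of [s1] and
   [s2]. *)
apply: (@prism_path v g1 g2 (s1 |: (nb g2 :\ v :\ s2)) (nb g3 :\ v)) => //.
- apply/independentP => x y; rewrite !inE.
  case/predU1P=> [->|/and3P[xs2 xv g2x]]; case/predU1P=> [->|/and3P[ys2 yv g2y]] xy;
    try graph_contra.
  + by case/eqP: ys2; apply: s1P.
  + by case/eqP: xs2; apply: s1P; rewrite // adj_sym.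
- by apply/independentP => x y; rewrite !inE => *; graph_split; graph_contra.
- rewrite disjoints_subset; apply/subsetP => x; rewrite !inE negb_and negbK.
  case/predU1P=> [->|/and3P[_ xv g2x]]; apply/orP; right; apply/negP => g3x.
    by apply: (dis g3 g1 s1).
  by apply: (dis g2 g3 x).
- by rewrite !inE eqxx andbF orbF eq_sym.
- by move=> w; rewrite !inE => /andP[wv g3w] vw; graph_contra.
- by exists s1; rewrite // !inE eqxx.
- have [t [g2t tv ts2]] := third_nb v s2 (d3 g2).
  by exists t; rewrite // !inE g2t tv ts2 orbT.
- move=> x /orP[g1x|g2x] xv; right; first exact: (sat g1).
  by apply: (sat g2) => //; rewrite eq_sym.
Qed.
End Prism.

(** * Isomorphisms and the two exceptional products *)

Lemma iso_sym (G H : sgraph) : isomorphic G H -> isomorphic H G.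
Proof.
move=> [f [g fK gK] f_adj]; exists g; first by exists f.
by move=> x y; rewrite -f_adj !gK.
Qed.

Lemma iso_trans (G H K : sgraph) :
  isomorphic G H -> isomorphic H K -> isomorphic G K.
Proof.
move=> [f bf f_adj] [g bg g_adj]; exists (g \o f); first exact: bij_comp.
by move=> x y; rewrite /= g_adj f_adj.
Qed.

Lemma iso_cartesian (G G' H H' : sgraph) :
  isomorphic G G' -> isomorphic H H' -> isomorphic (G □ H) (G' □ H').
Proof.
move=> [f [f' fK f'K] f_adj] [g [g' gK g'K] g_adj].
exists (fun p : G □ H => (f p.1, g p.2) : G' □ H').
  by exists (fun p : G' □ H' => (f' p.1, g' p.2) : G □ H) => -[x y] /=;
    rewrite ?fK ?gK ?f'K ?g'K.
move=> [a b] [c d]; rewrite !cart_adjE /= f_adj g_adj.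
by rewrite (inj_eq (can_inj fK)) (inj_eq (can_inj gK)).
Qed.

Lemma iso_swap (G H : sgraph) : isomorphic (G □ H) (H □ G).
Proof.
exists (fun p : G □ H => (p.2, p.1) : H □ G).
  by exists (fun p : H □ G => (p.2, p.1) : G □ H) => -[].
by move=> [a b] [c d]; rewrite !cart_adjE /= orbC.
Qed.

(** Turns maximality into one Boolean equation per vertex. The equations are transported along
    isomorphisms and solved exhaustively for the two exceptional products. *)
Lemma maxset_independentP (G : sgraph) (A : {set G}) :
  maxset (@independent G) A <-> forall x, (x \in A) = [forall y in A, ~~ adj x y].
Proof.
split=> [/maxsetP[/independentP iA maxA] x|A_E].
  apply/idP/forall_inP => [xA y yA|nox]; first by apply/negP/iA.
  suff <- : x |: A = A by rewrite !inE eqxx.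
  apply: maxA; last exact: subsetUr.
  apply/independentP => a b; rewrite !inE => /predU1P[->|aA] /predU1P[->|bA].
  - by rewrite adj_irr.
  - by apply/negP/nox.
  - by rewrite adj_sym; apply/negP/nox.
  - exact: iA.
apply/maxsetP; split.
  by apply/forall_inP => x; rewrite A_E.
move=> B /forall_inP iB sAB; apply/eqP; rewrite eqEsubset sAB andbT.
apply/subsetP => x /iB /forall_inP nox; rewrite A_E.
by apply/forall_inP => y /(subsetP sAB) /nox.
Qed.

Lemma iso_well_covered (G H : sgraph) :
  isomorphic G H -> well_covered H -> well_covered G.
Proof.
move=> [f [g fK gK] f_adj] wc.
have max A : maxset (@independent G) A -> maxset (@independent H) (f @: A).
  move=> /maxset_independentP A_E; apply/maxset_independentP => x.
  rewrite -[x]gK (mem_imset _ _ (can_inj fK)) A_E.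
  apply/forall_inP/forall_inP => [no _ /imsetP[y yA ->]|no y yA].
    by rewrite f_adj; apply: no.
  by rewrite -f_adj; apply: no; apply: imset_f.
move=> A B /max mA /max mB; have := wc _ _ mA mB.
by rewrite !(card_imset _ (can_inj fK)).
Qed.

Lemma maxset_nb (G : sgraph) (A : {set G}) (x : G) (s : seq G) :
  maxset (@independent G) A -> (forall y, adj x y = (y \in s)) ->
  (x \in A) = ~~ has (mem A) s.
Proof.
move=> /maxset_independentP -> xE; rewrite -all_predC; apply/forall_inP/allP => no y.
  by move=> ys; apply/negP => /no; rewrite xE ys.
by move=> yA; rewrite xE; apply/negP => /no /=; rewrite yA.
Qed.

Lemma card_count (T : finType) (A : {set T}) (s : seq T) :
  uniq s -> (forall x, x \in s) -> #|A| = count (mem A) s.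
Proof.
move=> s_uniq s_all; rewrite cardE /enum_mem size_filter.
have /permP -> // : perm_eq (Finite.enum T) s.
apply: uniq_perm => [||x] //; first by rewrite -enumT enum_uniq.
by rewrite -enumT mem_enum s_all.
Qed.

Ltac vertex_cases := case=> [[[|[|[|[|[|//]]]]] ?] [[|[|//]] ?]].

Lemma well_covered_K2K2 : well_covered (complete_graph 2 □ complete_graph 2).
Proof.
suff card2 A : maxset (@independent (complete_graph 2 □ complete_graph 2)) A -> #|A| = 2.
  by move=> A B /card2 -> /card2 ->.
move=> maxA.
pose x i (lt_i : i < 2) j (lt_j : j < 2) : complete_graph 2 □ complete_graph 2 :=
  (Ordinal lt_i, Ordinal lt_j).
pose a0 := @x 0 isT 0 isT; pose a1 := @x 1 isT 0 isT.
pose b0 := @x 0 isT 1 isT; pose b1 := @x 1 isT 1 isT.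
rewrite (@card_count _ A [:: a0; a1; b0; b1]) //; last by vertex_cases.
have /= Ea0 : (a0 \in A) = ~~ has (mem A) [:: a1; b0].
  by apply: maxset_nb maxA _; vertex_cases.
have /= Ea1 : (a1 \in A) = ~~ has (mem A) [:: a0; b1].
  by apply: maxset_nb maxA _; vertex_cases.
have /= Eb0 : (b0 \in A) = ~~ has (mem A) [:: b1; a0].
  by apply: maxset_nb maxA _; vertex_cases.
have /= Eb1 : (b1 \in A) = ~~ has (mem A) [:: b0; a1].
  by apply: maxset_nb maxA _; vertex_cases.
move: Ea0 Ea1 Eb0 Eb1 => /=.
by do 4!case: (_ \in A).
Qed.

Lemma well_covered_C5K2 : well_covered (cycle_graph 5 □ complete_graph 2).
Proof.
suff card4 A : maxset (@independent (cycle_graph 5 □ complete_graph 2)) A -> #|A| = 4.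
  by move=> A B /card4 -> /card4 ->.
move=> maxA.
pose x i (lt_i : i < 5) j (lt_j : j < 2) : cycle_graph 5 □ complete_graph 2 :=
  (Ordinal lt_i, Ordinal lt_j).
pose a0 := @x 0 isT 0 isT; pose b0 := @x 0 isT 1 isT.
pose a1 := @x 1 isT 0 isT; pose b1 := @x 1 isT 1 isT.
pose a2 := @x 2 isT 0 isT; pose b2 := @x 2 isT 1 isT.
pose a3 := @x 3 isT 0 isT; pose b3 := @x 3 isT 1 isT.
pose a4 := @x 4 isT 0 isT; pose b4 := @x 4 isT 1 isT.
rewrite (@card_count _ A [:: a0; a1; a2; a3; a4; b0; b1; b2; b3; b4]) //; last by vertex_cases.
have /= Ea0 : (a0 \in A) = ~~ has (mem A) [:: a1; a4; b0].
  by apply: maxset_nb maxA _; vertex_cases.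
have /= Eb0 : (b0 \in A) = ~~ has (mem A) [:: b1; b4; a0].
  by apply: maxset_nb maxA _; vertex_cases.
have /= Ea1 : (a1 \in A) = ~~ has (mem A) [:: a2; a0; b1].
  by apply: maxset_nb maxA _; vertex_cases.
have /= Eb1 : (b1 \in A) = ~~ has (mem A) [:: b2; b0; a1].
  by apply: maxset_nb maxA _; vertex_cases.
have /= Ea2 : (a2 \in A) = ~~ has (mem A) [:: a3; a1; b2].
  by apply: maxset_nb maxA _; vertex_cases.
have /= Eb2 : (b2 \in A) = ~~ has (mem A) [:: b3; b1; a2].
  by apply: maxset_nb maxA _; vertex_cases.
have /= Ea3 : (a3 \in A) = ~~ has (mem A) [:: a4; a2; b3].
  by apply: maxset_nb maxA _; vertex_cases.
have /= Eb3 : (b3 \in A) = ~~ has (mem A) [:: b4; b2; a3].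
  by apply: maxset_nb maxA _; vertex_cases.
have /= Ea4 : (a4 \in A) = ~~ has (mem A) [:: a0; a3; b4].
  by apply: maxset_nb maxA _; vertex_cases.
have /= Eb4 : (b4 \in A) = ~~ has (mem A) [:: b0; b3; a4].
  by apply: maxset_nb maxA _; vertex_cases.
move: Ea0 Eb0 Ea1 Eb1 Ea2 Eb2 Ea3 Eb3 Ea4 Eb4 => /=; clear.
(* Among all assignments to the ten memberships, those satisfying the ten equations have exactly
   four true values. *)
by do 10!case: (_ \in A).
Qed.

(** * Recognition of the factors and the final case analysis *)

Lemma K2_edge (H : sgraph) : nontrivial H -> connected H -> #|H| = 2 ->
  exists h h' : H, [/\ h != h', [set h; h'] = setT,
    forall k, adj h k = (k == h') & forall k, adj h' k = (k == h)].
Proof.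
move=> ntH cH H2; have [h _] : exists h : H, true.
  by case/card_gt1P: ntH => h _; exists h.
have [h' hh'] := connected_nb h ntH cH.
have hT : [set h; h'] = setT.
  by apply/eqP; rewrite eqEcard subsetT cardsT H2 cards2 (adj_neq hh').
have kE k : (k == h) || (k == h') by have := in_setT k; rewrite -hT !inE.
exists h, h'; split=> // [|k|k]; first exact: adj_neq.
  have /orP[/eqP->|/eqP->] := kE k; last by rewrite eqxx.
  by rewrite adj_irr (negPf (adj_neq hh')).
have /orP[/eqP->|/eqP->] := kE k; first by rewrite eqxx adj_sym.
by rewrite adj_irr eq_sym (negPf (adj_neq hh')).
Qed.

Lemma iso_K2 (H : sgraph) : nontrivial H -> connected H -> #|H| = 2 ->
  isomorphic H (complete_graph 2).
Proof.
move=> ntH cH H2; have [h [h' [nhh' _ hE h'E]]] := K2_edge ntH cH H2.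
apply: iso_sym; exists (fun i : complete_graph 2 => if i == ord0 then h else h').
  apply: inj_card_bij; last by rewrite H2 card_ord.
  move=> [[|[|//]] lt_i] [[|[|//]] lt_j] //= => [_|e|e|_]; try exact: val_inj.
    by rewrite e eqxx in nhh'.
  by rewrite e eqxx in nhh'.
case=> [[|[|//]] ?] [[|[|//]] ?] /=; rewrite ?hE ?h'E ?eqxx // ?(negPf nhh') //.
by rewrite eq_sym (negPf nhh').
Qed.

Lemma iso_C5 (G : sgraph) (v u s t w : G) :
  nb v = [set u; w] -> nb u = [set v; s] -> nb s = [set u; t] ->
  nb t = [set s; w] -> nb w = [set v; t] -> uniq [:: v; u; s; t; w] ->
  [set v; u; s; t; w] = setT -> isomorphic G (cycle_graph 5).
Proof.
move=> nv nu ns nt nw U T.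
pose f (i : cycle_graph 5) := nth v [:: v; u; s; t; w] i.
have f_inj : injective f.
  by move=> i j /eqP; rewrite nth_uniq // => /eqP/val_inj.
apply: iso_sym; exists f.
  apply: inj_card_bij => //; rewrite -[#|G|]cardsT -T -cardsT.
  apply: leq_trans (leq_imset_card f _); apply/subset_leq_card/subsetP => y.
  have fP i lt_i : f (@Ordinal 5 i lt_i) \in f @: setT by apply: imset_f.
  rewrite !inE -!orbA => /or4P[|||/orP[]]/eqP->.
  - exact: (fP 0 isT).
  - exact: (fP 1 isT).
  - exact: (fP 2 isT).
  - exact: (fP 3 isT).
  - exact: (fP 4 isT).
have fE i y : adj (f i) y = (y == f (ordS i)) || (y == f (ord_pred i)).
  by case: i => [[|[|[|[|[|//]]]]] ?];
    rewrite -in_nb /f /= ?nv ?nu ?ns ?nt ?nw !inE // orbC.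
move=> i j; rewrite fE !(inj_eq f_inj).
by case: i => [[|[|[|[|[|//]]]]] ?]; case: j => [[|[|[|[|[|//]]]]] ?].
Qed.

Lemma prism_C5 (G H : sgraph) :
  nontrivial G -> nontrivial H -> connected G -> connected H ->
  C3free G -> C4free G -> well_covered (G □ H) ->
  (forall g : G, 1 < #|nb g|) -> #|H| = 2 -> isomorphic G (cycle_graph 5).
Proof.
move=> ntG ntH cG cH G3 G4 wc dG H2.
have [h [h' [_ _ hE h'E]]] := K2_edge ntH cH H2.
have [/existsP[v /existsP[u /and3P[/eqP dv /eqP du vu]]]|noadj] := boolP
  [exists v : G, exists u : G, [&& #|nb v| == 2, #|nb u| == 2 & adj v u]].
  have [w [s [t [[nv nu ns nt nw] [U T]]]]] :=
    adj_deg2_C5 wc G3 G4 hE h'E dG cG dv du vu.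
  exact: iso_C5 nv nu ns nt nw U T.
have deg2_indep (x y : G) : #|nb x| == 2 -> #|nb y| == 2 -> adj x y -> False.
  move=> dx dy xy; case/negP: noadj; apply/existsP; exists x; apply/existsP.
  by exists y; rewrite dx dy.
have d3 (g : G) : 2 < #|nb g|.
  rewrite ltn_neqAle dG andbT eq_sym; apply/negP.
  exact: (no_deg2_prism wc G3 G4 hE h'E dG deg2_indep).
have [g _] : exists g : G, true by case/card_gt1P: ntG => g _; exists g.
by case: (no_min_deg3_prism wc G3 G4 hE h'E dG g d3).
Qed.

Lemma well_covered_swap_factors (G H : sgraph) :
  well_covered (G □ H) -> well_covered (H □ G).
Proof. exact/iso_well_covered/iso_swap. Qed.

(** If some vertex of [G] has degree 2, [no_deg2_factor] applies with the factors exchanged;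
    otherwise all degrees in [G] are at least 3. *)
Lemma no_min_deg2_factors (G H : sgraph) :
  nontrivial G -> nontrivial H -> C3free G -> C4free G -> C3free H -> C4free H ->
  (forall g : G, 1 < #|nb g|) -> (forall h : H, 1 < #|nb h|) ->
  well_covered (G □ H) -> False.
Proof.
move=> ntG ntH G3 G4 H3 H4 dG dH wc.
have [/existsP[g /eqP dg]|/existsPn no2] := boolP [exists g : G, #|nb g| == 2].
  exact: (no_deg2_factor (well_covered_swap_factors wc) H3 H4 G3 dH dG ntH dg).
have [g _] : exists g : G, true by case/card_gt1P: ntG => g _; exists g.
have [h _] : exists h : H, true by case/card_gt1P: ntH => h _; exists h.
apply: (no_min_deg3_factor g wc G3 G4 H3 _ (dH h)) => x.
by rewrite ltn_neqAle dG andbT eq_sym no2.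
Qed.

Theorem theorem3p1 (G H : sgraph)
    (ntG : nontrivial G) (ntH : nontrivial H)
    (connG : connected G) (connH : connected H)
    (girthG : girth_at_least 5 G) (girthH : girth_at_least 5 H) :
  well_covered (G □ H) <->
    isomorphic (G □ H) (complete_graph 2 □ complete_graph 2) \/
    isomorphic (G □ H) (cycle_graph 5 □ complete_graph 2).
Proof.
have [G3 G4] := (girth5_C3free girthG, girth5_C4free girthG).
have [H3 H4] := (girth5_C3free girthH, girth5_C4free girthH).
split=> [wc|[] iso]; last 2 first.
- exact: iso_well_covered iso well_covered_K2K2.
- exact: iso_well_covered iso well_covered_C5K2.
have wc' := well_covered_swap_factors wc.
have [G2|dG] := min_deg_ge2 ntG ntH connG connH G3 H3 wc;
  have [H2|dH] := min_deg_ge2 ntH ntG connH connG H3 G3 wc'.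
- by left; apply: iso_cartesian; apply: iso_K2.
(* Here [G] is the factor [K_2], so the factors are exchanged first and [H] is recognised as
   [C_5]. *)
- right; apply: iso_trans (iso_swap _ _) _; apply: iso_cartesian.
    exact: prism_C5 ntH ntG connH connG H3 H4 wc' dH G2.
  exact: iso_K2.
- right; apply: iso_cartesian; last exact: iso_K2.
  exact: prism_C5 ntG ntH connG connH G3 G4 wc dG H2.
- by case: (no_min_deg2_factors ntG ntH G3 G4 H3 H4 dG dH wc).
Qed.
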